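(* Let $k\ge 2$ be a fixed integer. Then, as $m\to\infty$, $$\chi_{\ell}(K(k,m),1)=(1+o(1))\,\chi_{\ell}(K(k,m))=(1+o(1))\log_{k/(k-1)} m,$$ i.e. both $\chi_{\ell}(K(k,m),1)/\log_{k/(k-1)} m\to 1$ and $\chi_{\ell}(K(k,m))/\log_{k/(k-1)} m\to 1$.
   Context: $K(k,m)=K_{m,m,\dots,m}$ is the complete multipartite graph with $k$ partite sets each of size $m$. For a hypergraph (or graph) $G$, a list $L$ assigns to each vertex $v$ a set $L(v)$ of colors; $G$ is $L$-colorable if there is a coloring $f$ with $f(v)\in L(v)$ for all $v$ such that no edge is monochromatic. $L$ is an $l$-list if $|L(v)|=l$ for all $v$. The list chromatic number $\chi_{\ell}(G)$ is the least $l$ such that $G$ is $L$-colorable from every $l$-list $L$. For a positive integer $s$, a list $L$ is $s$-separated if $|L(u)\cap L(v)|\le s$ whenever some edge of $G$ contains both $u$ and $v$; $\chi_{\ell}(G,s)$ is the least $l$ such that $G$ is $L$-colorable from every $s$-separated $l$-list $L$. *)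

(* Defs.v *)
From HB Require Import structures.
From mathcomp Require Import all_boot all_order all_algebra.
From mathcomp Require Import all_classical all_reals all_analysis.

Set Implicit Arguments.
Unset Strict Implicit.
Unset Printing Implicit Defensive.

Import Order.TTheory GRing.Theory Num.Theory.

(* A hypergraph on the finite vertex type V is its set of edges
   E : {set {set V}}; a graph is one all of whose edges are pairs. *)

Section Hypergraph.
Variable V : finType.
Implicit Type E : {set {set V}}.

Definition monochromatic (C : Type) (f : V -> C) (e : {set V}) : Prop :=
  exists c : C, forall v, v \in e -> f v = c.

(* Lists are finite sets and V is finite, so a finite palette C is no
   restriction; C itself is arbitrary and of unbounded size. *)
Definition L_colorable E (C : finType) (L : V -> {set C}) : Prop :=
  exists2 f : V -> C, (forall v, f v \in L v) &
    (forall e, e \in E -> ~ monochromatic f e).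

Definition is_l_list (C : finType) (l : nat) (L : V -> {set C}) : Prop :=
  forall v, #|L v| = l.

(* u and v are distinct vertices: with u = v allowed, the condition would
   bound the size of the lists themselves. *)
Definition separated E (s : nat) (C : finType) (L : V -> {set C}) : Prop :=
  forall u v : V, u != v ->
    (exists2 e, e \in E & (u \in e) && (v \in e)) -> #|L u :&: L v| <= s.

Definition choosable E (l : nat) : Prop :=
  forall (C : finType) (L : V -> {set C}), is_l_list l L -> L_colorable E L.

Definition sep_choosable E (s l : nat) : Prop :=
  forall (C : finType) (L : V -> {set C}),
    is_l_list l L -> separated E s L -> L_colorable E L.

End Hypergraph.

Definition is_least (P : nat -> Prop) (l : nat) : Prop :=
  P l /\ forall l', P l' -> l <= l'.

(* The junk value 0 is taken only when P has no solution; see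
   choosable_card below. *)
Definition least (P : nat -> Prop) : nat := xget 0 (is_least P).

Definition list_chromatic (V : finType) (E : {set {set V}}) : nat :=
  least (choosable E).

Definition sep_list_chromatic (V : finType) (E : {set {set V}}) (s : nat) : nat :=
  least (sep_choosable E s).

(* Vertex (i, j) is the j-th vertex of the i-th partite set. *)
Definition complete_multipartite (k m : nat) : {set {set 'I_k * 'I_m}} :=
  [set [set p.1; p.2] | p : ('I_k * 'I_m) * ('I_k * 'I_m) & p.1.1 != p.2.1].

Definition logb (R : realType) (b x : R) : R := (ln x / ln b)%R.

Lemma least_spec (P : nat -> Prop) (n : nat) : P n -> is_least P (least P).
Proof.
move=> Pn; apply: (@xgetPex _ 0 (is_least P)).
have ex : exists n, `[< P n >] by exists n; apply/asboolP.
exists (ex_minn ex); case: ex_minnP => l /asboolP Pl lmin; split=> // l' Pl'.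
by apply: lmin; apply/asboolP.
Qed.

Lemma choosable_card (V : finType) (E : {set {set V}}) :
  (forall e, e \in E -> 1 < #|e|) -> choosable E #|V|.
Proof.
move=> E2 C L hL.
have [f fL finj] : exists2 f : V -> C, (forall v, f v \in L v) &
    {in enum V &, injective f}.
  have: size (enum V) <= #|V| by rewrite -cardE.
  elim: (enum V) (enum_uniq V) => [|x s IHs] /=.
    move=> _ _; have ne v : exists c, c \in L v.
      by apply/card_gt0P; rewrite hL; apply/card_gt0P; exists v.
    by exists (fun v => xchoose (ne v)) => // v; apply: xchooseP.
  move=> /andP[xs us] szs; have [f fL fi] := IHs us (ltnW szs).
  have /card_gt0P[c] : 0 < #|L x :\: [set c in map f s]|.
    rewrite cardsD hL subn_gt0; apply: leq_ltn_trans szs.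
    apply: leq_trans (subset_leq_card (subsetIr _ _)) _.
    by rewrite cardsE -(size_map f s) card_size.
  rewrite !inE => /andP[cs cL].
  exists (fun v => if v == x then c else f v).
    by move=> v; case: eqP => [->|].
  move=> u v; rewrite !inE.
  case: eqP => [->|_] /=; case: eqP => [->|_] //=.
  - by move=> _ vs E1; rewrite E1 map_f in cs.
  - by move=> us' _ E1; rewrite -E1 map_f in cs.
  - exact: fi.
exists f => // e /E2 /card_gt1P[u [v [ue ve uv]]] [c fc].
have uEv : u = v by apply: finj; rewrite ?mem_enum // !fc.
by rewrite uEv eqxx in uv.
Qed.

Lemma complete_multipartite_gt1 (k m : nat) e :
  e \in complete_multipartite k m -> 1 < #|e|.
Proof.
case/imsetP=> -[u v] /=; rewrite inE /= => uv ->.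
by rewrite cards2; case: (eqVneq u v) uv => [->|//]; rewrite eqxx.
Qed.

Lemma list_chromatic_least (k m : nat) :
  is_least (choosable (complete_multipartite k m))
           (list_chromatic (complete_multipartite k m)).
Proof.
exact: least_spec (choosable_card (@complete_multipartite_gt1 k m)).
Qed.

Lemma sep_list_chromatic_least (k m s : nat) :
  is_least (sep_choosable (complete_multipartite k m) s)
           (sep_list_chromatic (complete_multipartite k m) s).
Proof.
apply: (@least_spec _ #|{: 'I_k * 'I_m}|) => C L hL _.
exact: choosable_card (@complete_multipartite_gt1 k m) _ _ hL.
Qed.

(* Main.v *)
(* A proper coloring of K(k, m) from lists amounts to reserving each color for
   one of the k parts so that every list contains a color reserved for its part.
   Upper bound: a random reservation fails on a given list of size l with
   probability ((k-1)/k)^l, so lists of size l suffice once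
   k m ((k-1)/k)^l < 1.
   Lower bound, already for 1-separated lists: take the grid [n]^k as palette,
   n = 2 k l^2, and let the lists of part i be subsets of lines in direction i;
   lines in different directions share at most one point.  Some part i uses at
   most a 1/k fraction of the grid, hence of some line in direction i, and if
   each line carries about n (k/(k-1))^l random l-subsets, one of them avoids
   that fraction.  This needs m of order l^O(k) (k/(k-1))^l only, which is
   l = (1 - o(1)) log_{k/(k-1)} m. *)

Require Import Defs.
From HB Require Import structures.
From mathcomp Require Import all_boot all_order all_algebra.
From mathcomp Require Import all_classical all_reals all_analysis.
Import Order.TTheory GRing.Theory Num.Theory.
Import numFieldNormedType.Exports.
From mathcomp Require Import zify ring lra.

Set Implicit Arguments.
Unset Strict Implicit.
Unset Printing Implicit Defensive.

(** * Union bound and the upper bound by random reservation *)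

Lemma leq_card_bigcup (S T : finType) (A : S -> {set T}) :
  #|\bigcup_s A s| <= \sum_s #|A s|.
Proof.
elim/big_rec2: _ => [|s n B _ IH]; first by rewrite cards0.
exact: leq_trans (leq_card_setU _ _) (leq_add (leqnn _) IH).
Qed.

Lemma union_bound (S T : finType) (A : S -> {set T}) (P : {set T}) :
  \sum_s #|A s| < #|P| -> exists2 x, x \in P & forall s, x \notin A s.
Proof.
move=> small.
have /card_gt0P[x] : 0 < #|P :\: \bigcup_s A s|.
  rewrite cardsD subn_gt0; apply: leq_ltn_trans small.
  exact: leq_trans (subset_leq_card (subsetIr _ _)) (leq_card_bigcup A).
rewrite inE => /andP[/bigcupP nx xP]; exists x => // s.
by apply/negP => xs; apply: nx; exists s.
Qed.

(** These maps form a product: k-1 values on each color of [A], k values elsewhere. The factor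
    [k ^ #|A|] on the left replaces a division, so this is the probability ((k-1)/k)^|A| in
    integers. *)
Lemma card_ffun_avoiding (C : finType) (k : nat) (A : {set C}) (i : 'I_k) :
  #|[set g : {ffun C -> 'I_k} | [forall c in A, g c != i]]| * k ^ #|A| =
  k.-1 ^ #|A| * k ^ #|C|.
Proof.
pose F (c : C) := [pred x : 'I_k | (c \in A) ==> (x != i)].
have -> : #|[set g : {ffun C -> 'I_k} | [forall c in A, g c != i]]|
   = #|family F|.
  rewrite cardsE; apply: eq_card => g; rewrite !inE.
  by apply/forallP/familyP => h c; have := h c.
rewrite card_family foldrE big_map big_enum /= (bigID (mem A)) /=.
rewrite (eq_bigr (fun=> k.-1)); last first.
  move=> c cA; rewrite -[k in RHS]card_ord -(cardC1 i); apply: eq_card => x.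
  by rewrite !inE cA.
rewrite [X in _ * X * _](eq_bigr (fun=> k)); last first.
  move=> c /negbTE cA; rewrite -[RHS]card_ord; apply: eq_card => x.
  by rewrite !inE cA.
rewrite !prod_nat_const -mulnA -expnD; congr (_ * k ^ _).
by rewrite addnC cardC.
Qed.

Lemma complete_multipartite_edge (k m : nat) (u v : 'I_k * 'I_m) :
  u.1 != v.1 -> [set u; v] \in complete_multipartite k m.
Proof. by move=> uv; apply/imsetP; exists (u, v); rewrite ?inE. Qed.

(* A uniformly random map g from the palette to the parts is used to reserve
   each color for one part. *)
Lemma multipartite_choosable (k m l : nat) : 0 < k ->
  k * m * k.-1 ^ l < k ^ l -> choosable (complete_multipartite k m) l.
Proof.
move=> k0 small C L hL.
pose A (v : 'I_k * 'I_m) :=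
  [set g : {ffun C -> 'I_k} | [forall c in L v, g c != v.1]].
have [|g _ hg] := @union_bound _ _ A [set: {ffun C -> 'I_k}].
  rewrite -(@ltn_pmul2r (k ^ l)) ?expn_gt0 ?k0 // big_distrl /=.
  rewrite (eq_bigr (fun=> k.-1 ^ l * k ^ #|C|)); last first.
    by move=> v _; rewrite -(hL v) card_ffun_avoiding.
  rewrite sum_nat_const card_prod !card_ord cardsT card_ffun card_ord mulnA.
  by rewrite [ltnRHS]mulnC ltn_pmul2r // expn_gt0 k0.
have ex v : exists c, (c \in L v) && (g c == v.1).
  have := hg v; rewrite inE negb_forall => /existsP[c].
  by rewrite negb_imply negbK => h; exists c.
exists (fun v => xchoose (ex v)) => [v|e].
  by case/andP: (xchooseP (ex v)).
case/imsetP => -[u v] /=; rewrite inE /= => uv -> [c hc].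
have [hu hv] : xchoose (ex u) = c /\ xchoose (ex v) = c.
  by rewrite !hc // !inE eqxx ?orbT.
have /andP[_ /eqP gu] := xchooseP (ex u).
have /andP[_ /eqP gv] := xchooseP (ex v).
by rewrite -gu -gv hu hv eqxx in uv.
Qed.

(** * Random l-subsets avoiding every sparse set *)

(** With denominators cleared: l independent draws from a elements are distinct with probability at
    least 1 - l^2/a. *)
Lemma ffact_lower (a l : nat) : (a - l ^ 2) * a ^ l <= a ^_ l * a.
Proof.
elim: l => [|l IH]; first by rewrite expn0 ffactn0 muln1 mul1n leq_subr.
have [la|la] := leqP a (l.+1 ^ 2).
  by move: la; rewrite -subn_eq0 => /eqP ->.
rewrite ffactnSr (expnS a l).
have h2 : (a - l ^ 2) * (a - l) * a ^ l <= a ^_ l * a * (a - l).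
  by rewrite mulnAC leq_mul2r IH orbT.
have h1 : (a - l.+1 ^ 2) * a <= (a - l ^ 2) * (a - l).
  have -> : a - l ^ 2 = (a - l.+1 ^ 2) + (2 * l + 1) by lia.
  have ca : a - l.+1 ^ 2 <= a - l by lia.
  have aE : a = (a - l) + l by lia.
  rewrite {2}aE mulnDl mulnDr leq_add2l mulnC.
  by apply: leq_mul => //; lia.
rewrite mulnA [leqRHS]mulnAC; apply: leq_trans h2.
by rewrite leq_mul2r h1 orbT.
Qed.

Lemma ffact_le_expn (a l : nat) : a ^_ l <= a ^ l.
Proof.
by elim: l => // l IH; rewrite ffactnSr expnSr leq_mul // leq_subr.
Qed.

Lemma ffact_half (a l : nat) : 0 < a -> 2 * l ^ 2 <= a -> a ^ l <= 2 * a ^_ l.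
Proof.
move=> a0 la; rewrite -(leq_pmul2r a0) -mulnA.
apply: (@leq_trans (2 * ((a - l ^ 2) * a ^ l))); last first.
  by rewrite leq_mul2l ffact_lower.
by rewrite mulnA mulnC leq_mul2r; apply/orP; right; lia.
Qed.

(** The first two terms of the binomial expansion of ((p-d)+d)^r suffice: the second is r d
    (p-d)^(r-1), at least (p-d)^r because r d >= p. *)
Lemma double_expn_le (p d r : nat) : d <= p -> 0 < r -> p <= r * d ->
  2 * (p - d) ^ r <= p ^ r.
Proof.
case: r => // r dp _ prd; rewrite -[p in leqRHS](subnK dp) expnDn.
rewrite 2!big_ord_recl /= /bump /= bin0 bin1 mul1n.
rewrite muln1 subn0 expn1 addnA mul2n -addnn.
apply: leq_trans (leq_addr _ _); rewrite leq_add2l.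
rewrite expnSr add1n subn1 /= mulnCA leq_mul2l.
by apply/orP; right; lia.
Qed.

(** Each block of r draws halves the probability of continued failure. There are n+1 blocks: n pay
    for a union bound over the subsets of [n], and one more makes it strict. *)
Lemma exp2_mul_expn_lt (n p d r : nat) : 0 < p -> d <= p -> 0 < r ->
  p <= r * d -> 2 ^ n * (p - d) ^ (r * n.+1) < p ^ (r * n.+1).
Proof.
move=> p0 dp r0 prd.
have [->|pd] := posnP (p - d).
  by rewrite exp0n ?muln0 ?expn_gt0 ?p0 // muln_gt0 r0.
have h : (2 * (p - d) ^ r) ^ n.+1 <= (p ^ r) ^ n.+1.
  by rewrite leq_exp2r // double_expn_le.
rewrite !expnM; apply: leq_trans h; rewrite expnMn ltn_pmul2r.
  by rewrite ltn_exp2l.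
by rewrite !expn_gt0 pd.
Qed.

(* A random l-subset of [n] avoids a set of density at most 1/k with
   probability at least ((k-1)/k)^l / 2. *)
Lemma exists_avoiding_family (k l r : nat) (n := k * (2 * l ^ 2)) :
  1 < k -> 0 < l -> 2 * k ^ l <= r * k.-1 ^ l ->
  exists2 U : 'I_(r * n.+1) -> {set 'I_n}, (forall t, #|U t| = l) &
    forall S : {set 'I_n}, k * #|S| <= n -> exists t, [disjoint U t & S].
Proof.
move=> k1 l0 hr.
set q := 2 * l ^ 2 in n *; set M := r * n.+1.
have q0 : 0 < q by rewrite /q muln_gt0 expn_gt0 l0.
have k0 : 0 < k by exact: ltnW.
have k10 : 0 < k.-1 by lia.
have r0 : 0 < r.
  have : 0 < k ^ l by rewrite expn_gt0 k0.
  by case: (r) hr => //; rewrite mul0n; lia.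
have ln : l <= k.-1 * q.
  rewrite -[l]mul1n leq_mul //; apply: (@leq_trans (l ^ 2)).
    by rewrite -{1}(expn1 l) leq_pexp2l.
  by rewrite leq_pmull.
pose P := [set B : {set 'I_n} | B \subset [set: 'I_n] & #|B| == l].
have cP : #|P| = 'C(n, l) by rewrite cards_draws cardsT card_ord.
(* A set of size at most n/k = [q] leaves at least [(k-1)q] points, hence at least [d] of the
   l-subsets avoid it. *)
pose d := 'C(k.-1 * q, l).
have nE : n = k.-1 * q + q by rewrite addnC -mulSn prednK.
have dp : d <= 'C(n, l) by rewrite leq_bin2l // nE leq_addr.
have p0 : 0 < 'C(n, l) by rewrite bin_gt0 nE; lia.
(* After multiplication by 2 l!, with a = (k-1)q: 2 n^_l <= 2 n^l <= r a^l <= 2 r a^_l. The last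
   inequality is why [q] is 2 l^2. *)
have prd : 'C(n, l) <= r * d.
  rewrite -(leq_pmul2r (fact_gt0 l)) -mulnA /d !bin_ffact.
  rewrite -(@leq_pmul2l 2) //.
  apply: (@leq_trans (2 * n ^ l)); first by rewrite leq_mul2l ffact_le_expn.
  rewrite mulnCA; apply: (@leq_trans (r * (k.-1 * q) ^ l)); last first.
    have a0 : 0 < k.-1 * q by rewrite muln_gt0 k10.
    by rewrite leq_mul // ffact_half // leq_pmull.
  rewrite /n (expnMn k q) (expnMn k.-1 q).
  by rewrite (mulnA 2) (mulnA r) leq_mul2r hr orbT.
(* Dense sets get an empty event, so that the union bound can run over all 2^n subsets. *)
pose bad (S : {set 'I_n}) :=
  if k * #|S| <= n then [set B in P | ~~ [disjoint B & S]] else finset.set0.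
have cbad S : #|bad S| <= 'C(n, l) - d.
  rewrite /bad; case: ifPn => [kS|_]; last by rewrite cards0.
  have Sq : #|S| <= q by move: kS; rewrite /n leq_pmul2l.
  have -> : [set B in P | ~~ [disjoint B & S]] =
      P :\: [set B : {set 'I_n} | B \subset ~: S & #|B| == l].
    apply/setP => B; rewrite !inE finset.disjoints_subset finset.subsetT /=.
    by case: (#|B| == l); rewrite ?andbT ?andbF.
  rewrite cardsD (finset.setIidPr _); last first.
    by apply/fintype.subsetP => B; rewrite !inE finset.subsetT => /andP[].
  rewrite cP cards_draws leq_sub2l // leq_bin2l // cardsCs finset.setCK card_ord.
  by lia.
pose A S := [set g : {ffun 'I_M -> {set 'I_n}} | g \in ffun_on (mem (bad S))].
have [|g gP hg] := @union_bound _ _ A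
    [set g : {ffun 'I_M -> {set 'I_n}} | g \in ffun_on (mem P)].
  rewrite [ltnRHS]cardsE card_ffun_on card_ord cP.
  apply: leq_ltn_trans (exp2_mul_expn_lt n p0 dp r0 prd).
  have <- : #|{set 'I_n}| = 2 ^ n.
    have := card_powerset [set: 'I_n]; rewrite cardsT card_ord => <-.
    by rewrite powersetT cardsT.
  rewrite -sum_nat_const; apply: leq_sum => S _.
  by rewrite cardsE card_ffun_on card_ord leq_exp2r ?cbad // /M muln_gt0 r0.
exists g => [t|S kS].
  by move: gP; rewrite inE => /ffun_onP/(_ t); rewrite !inE => /andP[_ /eqP].
have := hg S; rewrite inE => /ffun_onP h.
apply/existsP; apply: contraT; rewrite negb_exists => /forallP nd.
case: h => t; rewrite /bad kS inE nd andbT.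
by move: gP; rewrite inE => /ffun_onP.
Qed.

(** * Lines of the grid and the lower bound for 1-separated lists *)

Section Grid.
Variables k n : nat.
Implicit Types (x y : {ffun 'I_k -> 'I_n}) (i j : 'I_k) (a : 'I_n).

Definition set_coord x i a : {ffun 'I_k -> 'I_n} :=
  [ffun j => if j == i then a else x j].

Lemma set_coord_inj x i : injective (set_coord x i).
Proof. by move=> a b /ffunP/(_ i); rewrite !ffunE eqxx. Qed.

(** A common point is determined: the second line fixes its coordinate i, the first line all the
    others. *)
Lemma card_lines_meet x y i j (A B : {set 'I_n}) : i != j ->
  #|[set set_coord x i a | a in A] :&: [set set_coord y j b | b in B]| <= 1.
Proof.
move=> ij; apply/card_le1_eqP => z w; rewrite !inE.
case/andP=> /imsetP[a _ za] /imsetP[b _ zb].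
case/andP=> /imsetP[a' _ wa] /imsetP[b' _ wb].
apply/ffunP => h; have [hi|hi] := eqVneq h i.
  by rewrite zb wb !ffunE hi (negbTE ij).
by rewrite za wa !ffunE (negbTE hi).
Qed.

(* The involution (x, a) |-> (x with i-th coordinate a, x i) shows that the
   lines in direction i through all points x cover D evenly. *)
Lemma exists_sparse_line (D : {set {ffun 'I_k -> 'I_n}}) i : 0 < n ->
  k * #|D| <= n ^ k -> exists x, k * #|[set a | set_coord x i a \in D]| <= n.
Proof.
move=> n0 kD; apply/existsP; apply: contraT; rewrite negb_exists => /forallP h.
have sumE : \sum_x #|[set a | set_coord x i a \in D]| = #|D| * n.
  pose h2 (p : {ffun 'I_k -> 'I_n} * 'I_n) := (set_coord p.1 i p.2, p.1 i).
  have h2K : involutive h2.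
    case=> x a; rewrite /h2 /= !ffunE eqxx; congr pair.
    by apply/ffunP => j; rewrite !ffunE; case: eqP => [->|].
  transitivity (\sum_x \sum_a (set_coord x i a \in D : nat)).
    by apply: eq_bigr => x _; rewrite -sum1dep_card big_mkcond.
  rewrite pair_big /= (reindex_inj (inv_inj h2K)) /=.
  rewrite -(pair_big predT predT (fun x a =>
    (set_coord (set_coord x i a) i (x i) \in D : nat))) /=.
  rewrite -sum_nat_const [RHS]big_mkcond; apply: eq_bigr => x _.
  rewrite (eq_bigr (fun=> (x \in D : nat))) => [|a _]; last first.
    by have /(congr1 fst) /= -> := h2K (x, a).
  by rewrite sum_nat_const card_ord; case: (x \in D); rewrite ?muln0 ?muln1.
have : \sum_(x : {ffun 'I_k -> 'I_n}) n.+1 <=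
    \sum_x k * #|[set a | set_coord x i a \in D]|.
  by apply: leq_sum => x _; rewrite ltnNge h.
rewrite -big_distrr /= sumE mulnA sum_nat_const card_ffun !card_ord mulnS.
by move: kD; rewrite -(leq_pmul2r n0); have := expn_gt0 n k; rewrite n0; lia.
Qed.

End Grid.

Lemma exists_small_part (k : nat) (C : finType) (D : 'I_k -> {set C}) :
  0 < k -> (forall i j, i != j -> [disjoint D i & D j]) ->
  exists i, k * #|D i| <= #|C|.
Proof.
move=> k0 dis; apply/existsP; apply: contraT; rewrite negb_exists => /forallP h.
have : \sum_i #|D i| <= #|C|.
  under eq_bigr do rewrite -sum1_card big_mkcond.
  rewrite exchange_big /= -[leqRHS]sum1_card; apply: leq_sum => c _.
  rewrite -big_mkcond sum1dep_card; apply/card_le1_eqP => i j; rewrite !inE.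
  move=> ci cj; apply/eqP; apply: contraT => /dis /disjointFr/(_ cj).
  by rewrite ci.
have : \sum_(i < k) #|C|.+1 <= \sum_i k * #|D i|.
  by apply: leq_sum => i _; rewrite ltnNge h.
rewrite -big_distrr /= sum_nat_const card_ord leq_pmul2l //; lia.
Qed.

(* The lists of part i are subsets of lines in direction i of the grid [n]^k,
   so lists of different parts share at most one color.  The color class of
   some part i has density at most 1/k in the grid, hence on some line in
   direction i, and a list on that line avoids it. *)
Lemma sep_choosable_multipartite_lt (k m l r : nat) (n := k * (2 * l ^ 2)) :
  1 < k -> 0 < l -> 2 * k ^ l <= r * k.-1 ^ l ->
  sep_choosable (complete_multipartite k m) 1 l -> m < n ^ k * (r * n.+1).
Proof.
move=> k1 l0 hr ch; rewrite ltnNge; apply/negP => big.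
have [U cU hU] := exists_avoiding_family k1 l0 hr.
rewrite -/n in U cU hU *; set M := r * n.+1 in U cU hU big.
have n0 : 0 < n by rewrite /n !muln_gt0 l0 (ltnW k1).
pose C : finType := {ffun 'I_k -> 'I_n}.
pose W : finType := (C * 'I_M)%type.
have cW : #|W| = n ^ k * M by rewrite card_prod card_ffun !card_ord.
(* Avoiding the empty set shows that the index type is inhabited, which supplies the default
   [w0]. *)
have [t0 _] : exists t, [disjoint U t & finset.set0 : {set 'I_n}].
  by apply: hU; rewrite cards0 muln0.
pose w0 : W := ([ffun=> Ordinal n0], t0).
(* Since m is at least the number of pairs (base point, subset), the m vertices of each part can
   realize all of them; surplus vertices repeat [w0]. *)
pose dec (j : 'I_m) : W := nth w0 (enum W) j.
have decK (w : W) : exists j, dec j = w.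
  have wm : index w (enum W) < m.
    apply: leq_trans big; rewrite -cW [#|W|]cardE index_mem mem_enum //.
  by exists (Ordinal wm); rewrite /dec /= nth_index // mem_enum.
pose L (v : 'I_k * 'I_m) : {set C} :=
  [set set_coord (dec v.2).1 v.1 a | a in U (dec v.2).2].
have [||f fL fE] := ch C L.
- by move=> v; rewrite card_imset ?cU //; apply: set_coord_inj.
- move=> u v uv [e /imsetP[[u' v']]]; rewrite inE /= => p ->.
  rewrite !inE; case/andP => /orP[] /eqP eu /orP[] /eqP ev.
  + by rewrite eu ev eqxx in uv.
  + by apply: card_lines_meet; rewrite eu ev.
  + by apply: card_lines_meet; rewrite eu ev eq_sym.
  + by rewrite eu ev eqxx in uv.
(* The colors used on part i. Edges between different parts make these sets disjoint. *)
pose D (i : 'I_k) := [set f (i, j) | j : 'I_m].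
have [|i Di] := @exists_small_part k _ D (ltnW k1).
  move=> i i' ii'; rewrite -finset.setI_eq0; apply/eqP/finset.setP => c; rewrite !inE.
  apply/negP => /andP[/imsetP[j _ cj] /imsetP[j' _ cj']].
  apply: (fE _ (@complete_multipartite_edge k m (i, j) (i', j') ii')).
  by exists c => v; rewrite !inE => /orP[] /eqP ->.
have [|x kx] := @exists_sparse_line k n (D i) i n0.
  by move: Di; rewrite card_ffun !card_ord.
have [t dt] := hU _ kx; have [j jE] := decK (x, t).
have /imsetP[a] := fL (i, j); rewrite /= jE /= => aU fa.
move: dt => /disjointFr/(_ aU); rewrite inE -fa => /negP; apply.
exact: imset_f.
Qed.

Local Open Scope classical_set_scope.
Local Open Scope ring_scope.

(** * From logarithmic inequalities to the limit *)

Section Asymptotics.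
Variable R : realType.
Implicit Types (lam c A B : R).

Lemma ln_le_sqrt (x : R) : 0 < x -> ln x <= 2 * Num.sqrt x.
Proof.
move=> x0; have s0 : 0 < Num.sqrt x by rewrite sqrtr_gt0.
rewrite -{1}(sqr_sqrtr (ltW x0)) lnXn // -[ln _ *+ 2]mulr_natl.
by rewrite ler_pM2l // ltW // ln_sublinear.
Qed.

Lemma cvg_sqrt_ln_pinfty : Num.sqrt (ln (m%:R : R)) @[m --> \oo] --> +oo.
Proof.
apply/cvgryPge => A; near=> m.
have mA : expR (A ^+ 2) <= m%:R :> R.
  by near: m; apply: (cvgryPge _).1; exact: cvgr_idn.
have : A ^+ 2 <= ln m%:R.
  rewrite -(expRK (A ^+ 2)) ler_ln ?posrE ?expR_gt0 //.
  exact: lt_le_trans (expR_gt0 _) mA.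
move=> /(ler_wsqrtr); rewrite sqrtr_sqr; exact: le_trans (ler_norm _).
Unshelve. all: by end_near. Qed.

(** The first inequality gives u = O(ln m), so ln u = O(sqrt(ln m)); dividing both inequalities by
    ln m then leaves errors O(1/sqrt(ln m)), and u is squeezed. *)
Lemma cvg_div_log (u : nat -> nat) lam c A B : 0 < lam -> 0 <= A ->
  (\forall m \near \oo, [/\ (0 < u m)%N,
    (u m)%:R * lam <= ln (m%:R : R) + c &
    ln (m%:R : R) <= (u m)%:R * lam + A * ln (u m)%:R + B]) ->
  (u m)%:R / (ln (m%:R : R) / lam) @[m --> \oo] --> (1 : R).
Proof.
move=> lam0 A0 hu.
pose z m := (Num.sqrt (ln (m%:R : R)))^-1.
have z0 : z m @[m --> \oo] --> (0 : R).
  apply/gtr0_cvgV0; last exact: cvg_sqrt_ln_pinfty.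
  near=> m; suff : 1 <= Num.sqrt (ln (m%:R : R)) by apply: lt_le_trans.
  near: m; apply: (cvgryPge _).1; exact: cvg_sqrt_ln_pinfty.
(* Once ln m >= 1, u lam <= (1 + |c|) ln m, so sqrt u <= [K] sqrt(ln m). *)
pose K := Num.sqrt ((1 + `|c|) / lam).
have lo : 1 - 2 * A * K * z m - B * (z m * z m) @[m --> \oo] --> (1 : R).
  suff : 1 - 2 * A * K * z m - B * (z m * z m) @[m --> \oo] -->
      1 - 2 * A * K * 0 - B * (0 * 0) by rewrite !mulr0 !subr0.
  apply: cvgB; last by apply: cvgMl_tmp; apply: cvgM.
  by apply: cvgB; [exact: cvg_cst|apply: cvgMl_tmp].
have hi : 1 + c * (z m * z m) @[m --> \oo] --> (1 : R).
  suff : 1 + c * (z m * z m) @[m --> \oo] --> 1 + c * (0 * 0).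
    by rewrite !mulr0 addr0.
  by apply: cvgD; [exact: cvg_cst|apply: cvgMl_tmp; apply: cvgM].
apply: squeeze_cvgr lo hi; near=> m.
have [u0 h1 h2] : [/\ (0 < u m)%N,
    (u m)%:R * lam <= ln (m%:R : R) + c &
    ln (m%:R : R) <= (u m)%:R * lam + A * ln (u m)%:R + B].
  by near: m.
have s1 : 1 <= Num.sqrt (ln (m%:R : R)).
  near: m; apply: (cvgryPge _).1; exact: cvg_sqrt_ln_pinfty.
set s := Num.sqrt (ln m%:R) in s1.
have s0 : 0 < s by apply: lt_le_trans s1.
have y0 : 0 < ln (m%:R : R) by rewrite -sqrtr_gt0.
have yE : ln (m%:R : R) = s * s by rewrite -expr2 sqr_sqrtr // ltW.
have U0 : 0 < (u m)%:R :> R by rewrite ltr0n.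
have lnu : ln (u m)%:R <= 2 * (K * s).
  apply: le_trans (ln_le_sqrt U0) _; rewrite ler_pM2l //.
  rewrite -sqrtrM; last by rewrite divr_ge0 // ?addr_ge0 // ltW.
  apply: ler_wsqrtr; rewrite mulrAC ler_pdivlMr //.
  apply: le_trans h1 _; rewrite yE.
  have ss : 1 <= s * s by nra.
  have := ler_norm c; have := normr_ge0 c; nra.
rewrite yE in h1 h2 *.
have -> : (u m)%:R / (s * s / lam) = (u m)%:R * lam * (z m * z m).
  by rewrite /z -/s; field; rewrite !gt_eqF.
have zs : z m * s = 1 by rewrite /z mulVf // gt_eqF.
have zz : (z m * z m) * (s * s) = 1 by rewrite mulrACA zs mulr1.
have zz0 : 0 <= z m * z m by rewrite -expr2 sqr_ge0.
apply/andP; split; last first.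
  have := ler_wpM2r zz0 h1; rewrite mulrDl (mulrC (s * s)) zz; lra.
have AK : A * ln (u m)%:R <= A * (2 * (K * s)) by rewrite ler_wpM2l.
have h3 : s * s <= (u m)%:R * lam + A * (2 * (K * s)) + B by lra.
have := ler_wpM2r zz0 h3; rewrite 2!mulrDl (mulrC (s * s)) zz.
have -> : A * (2 * (K * s)) * (z m * z m) = 2 * A * K * z m * (z m * s) by ring.
rewrite zs; lra.
Unshelve. all: by end_near. Qed.

End Asymptotics.

(** * Explicit bounds and the theorem *)

(** Both chromatic numbers satisfy the hypotheses on [u], because choosability implies separated
    choosability; one statement thus serves both limits. *)
Lemma multipartite_log_bounds (R : realType) (k m u : nat) : (2 <= k)%N ->
  (0 < m)%N -> sep_choosable (complete_multipartite k m) 1 u ->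
  (forall l, (l < u)%N -> ~ choosable (complete_multipartite k m) l) ->
  let lam := ln (k%:R / (k%:R - 1) : R) in
  [/\ (0 < u)%N, u%:R * lam <= ln (m%:R : R) + (ln k%:R + lam) &
    ln (m%:R : R) <= u%:R * lam + (2 * k.+1)%:R * ln u%:R
      + ln (6 * (2 * k%:R) ^+ k.+1)].
Proof.
move=> k2 m0 su nu lam.
have k0 : (0 < k)%N by exact: ltnW.
pose v := k.-1; have v0 : (0 < v)%N by rewrite /v; lia.
have kv : k%:R - 1 = v%:R :> R by rewrite /v -subn1 natrB.
have K0 : 0 < k%:R :> R by rewrite ltr0n.
have V0 : 0 < v%:R :> R by rewrite ltr0n.
have M0 : 0 < m%:R :> R by rewrite ltr0n.
pose b : R := k%:R / v%:R.
have b0 : 0 < b by rewrite divr_gt0.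
have b1 : 1 <= b by rewrite ler_pdivlMr // mul1r ler_nat /v leq_pred.
have lamE : lam = ln b by rewrite /lam kv.
have bX l : b ^+ l = (k ^ l)%:R / (v ^ l)%:R by rewrite expr_div_n !natrX.
have u0 : (0 < u)%N.
  rewrite lt0n; apply/eqP => uE; move: su; rewrite uE => su.
  have [||f fL _] := su unit (fun=> finset.set0).
  - by move=> w; rewrite cards0.
  - by move=> w w' _ _; rewrite finset.set0I cards0.
  by have := fL (Ordinal k0, Ordinal m0); rewrite inE.
have U0 : 0 < u%:R :> R by rewrite ltr0n.
split=> //.
  (* The random reservation must fail at u-1; passing from u-1 to u costs the extra [lam]. *)
  have ul : (u.-1 < u)%N by rewrite prednK.
  have : (k ^ u.-1 <= k * m * v ^ u.-1)%N.
    by rewrite leqNgt; apply/negP => /(multipartite_choosable k0); apply: nu.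
  rewrite -(ler_nat R) natrM -ler_pdivrMr ?ltr0n ?expn_gt0 ?v0 // -bX natrM.
  move=> h; have : ln (b ^+ u.-1) <= ln (k%:R * m%:R).
    by rewrite ler_ln ?posrE //; [exact: exprn_gt0|exact: mulr_gt0].
  rewrite lnXn // lnM ?posrE // -lamE -mulr_natl.
  rewrite -[u in u%:R * lam](prednK u0) -natr1 mulrDl mul1r; lra.
(* This [r] satisfies [hr] and is at most 2 b^u + 1 <= 3 b^u. *)
pose r := ((2 * k ^ u) %/ v ^ u).+1.
have hr : (2 * k ^ u <= r * v ^ u)%N.
  by rewrite ltnW // ltn_ceil // expn_gt0 v0.
have := sep_choosable_multipartite_lt k2 u0 hr su.
set n := (k * (2 * u ^ 2))%N => mlt.
have n0 : (0 < n)%N by rewrite /n !muln_gt0 u0 k0.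
have rb : r%:R <= 3 * b ^+ u.
  rewrite /r -natr1.
  have : ((2 * k ^ u) %/ v ^ u)%:R <= 2 * b ^+ u.
    rewrite bX mulrA ler_pdivlMr ?ltr0n ?expn_gt0 ?v0 //.
    by rewrite -!natrM ler_nat leq_trunc_div.
  have : 1 <= b ^+ u by rewrite exprn_ege1.
  lra.
have nE : n%:R = 2 * k%:R * u%:R ^+ 2 :> R.
  by rewrite /n !natrM; ring.
have N0 : 0 < n%:R :> R by rewrite ltr0n.
(* The 6 is 3 from [r] times 2 from n+1 <= 2n; the other factors are n^(k+1) with n = 2 k u^2. *)
have mle : m%:R <= 6 * (2 * k%:R) ^+ k.+1 * (u%:R ^+ (2 * k.+1) * b ^+ u).
  have : m%:R <= (n ^ k * (r * (2 * n)))%:R :> R.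
    rewrite ler_nat (leq_trans (ltnW mlt)) // leq_mul // leq_mul //.
    by rewrite mul2n -addnn -addn1 leq_add.
  move/le_trans; apply.
  rewrite (natrM R (n ^ k)) natrX (natrM R r) (natrM R 2 n).
  have -> : 6 * (2 * k%:R) ^+ k.+1 * (u%:R ^+ (2 * k.+1) * b ^+ u) =
      n%:R ^+ k * ((3 * b ^+ u) * (2 * n%:R)).
    by rewrite exprM mulrA -(mulrA 6) -exprMn -nE exprS; ring.
  apply: ler_wpM2l; first by rewrite exprn_ge0.
  by apply: ler_wpM2r => //; rewrite mulr_ge0.
have c0 : 0 < 6 * (2 * k%:R) ^+ k.+1 :> R.
  by rewrite mulr_gt0 // exprn_gt0 // mulr_gt0.
have e0 : 0 < u%:R ^+ (2 * k.+1) :> R by rewrite exprn_gt0.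
have f0 : 0 < b ^+ u by rewrite exprn_gt0.
have ef0 := mulr_gt0 e0 f0.
have : ln (m%:R : R) <= ln (6 * (2 * k%:R) ^+ k.+1 *
    (u%:R ^+ (2 * k.+1) * b ^+ u)).
  by rewrite ler_ln ?posrE //; apply: mulr_gt0.
rewrite lnM ?posrE // [ln (_ ^+ _ * _)]lnM ?posrE // !lnXn // -lamE.
rewrite -(mulr_natl lam) -(mulr_natl (ln u%:R)); lra.
Qed.

Lemma choosable_sep_choosable (V : finType) (E : {set {set V}}) (s l : nat) :
  choosable E l -> sep_choosable E s l.
Proof. by move=> ch C L hL _; apply: ch. Qed.

Theorem theorem3 (R : realType) (k : nat) (hk : (2 <= k)%N) :
  [/\ (sep_list_chromatic (complete_multipartite k m) 1)%:R
        / (list_chromatic (complete_multipartite k m))%:R @[m --> \oo] --> (1 : R),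
      (sep_list_chromatic (complete_multipartite k m) 1)%:R
        / logb (k%:R / (k%:R - 1)) m%:R @[m --> \oo] --> (1 : R)
    & (list_chromatic (complete_multipartite k m))%:R
        / logb (k%:R / (k%:R - 1)) m%:R @[m --> \oo] --> (1 : R)].
Proof.
have lam0 : 0 < ln (k%:R / (k%:R - 1) : R).
  have K1 : 1 < k%:R :> R by rewrite ltr1n.
  by apply: ln_gt0; rewrite ltr_pdivlMr ?mul1r; lra.
have lim (u : nat -> nat) :
    (forall m, sep_choosable (complete_multipartite k m) 1 (u m)) ->
    (forall m l, (l < u m)%N -> ~ choosable (complete_multipartite k m) l) ->
    (u m)%:R / logb (k%:R / (k%:R - 1)) m%:R @[m --> \oo] --> (1 : R).
  move=> su nu; apply: (cvg_div_log lam0 (ler0n R (2 * k.+1))).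
  near=> m; apply: multipartite_log_bounds => //; last exact: nu.
  by near: m; exists 1%N.
have sepl : (sep_list_chromatic (complete_multipartite k m) 1)%:R
    / logb (k%:R / (k%:R - 1)) m%:R @[m --> \oo] --> (1 : R).
  apply: (lim (fun m => sep_list_chromatic (complete_multipartite k m) 1)) => m.
    exact: (sep_list_chromatic_least k m 1).1.
  move=> l lt /choosable_sep_choosable ch; move: lt; rewrite ltnNge.
  by rewrite (sep_list_chromatic_least k m 1).2.
have listl : (list_chromatic (complete_multipartite k m))%:R
    / logb (k%:R / (k%:R - 1)) m%:R @[m --> \oo] --> (1 : R).
  apply: (lim (fun m => list_chromatic (complete_multipartite k m))) => m.
    exact: choosable_sep_choosable (list_chromatic_least k m).1.
  by move=> l lt ch; move: lt; rewrite ltnNge (list_chromatic_least k m).2.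
split=> //.
have := cvgM sepl (cvgV (oner_neq0 R) listl); rewrite divr1 => ratio.
(* The common logarithm cancels only where it is nonzero, hence the restriction to m >= 2. *)
apply: (cvg_trans _ (ratio _ _)); apply: near_eq_cvg; near=> m => /=.
have m2 : (1 < m)%N by near: m; exists 2%N.
have y0 : 0 < logb (k%:R / (k%:R - 1)) (m%:R : R).
  by rewrite divr_gt0 // ln_gt0 // ltr1n.
by move: (logb _ _) y0 => y y0; rewrite invf_div mulrA mulfVK // gt_eqF.
Unshelve. all: by end_near. Qed.
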